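(* Every I-favorable topological space is universally Kuratowski-Ulam$^*$ (uK-U$^*$). That is, if $Y$ is an I-favorable topological space, then for every topological space $X$ and every nowhere dense set $E\subseteq X\times Y$ (with $X\times Y$ carrying the product topology), the set $$\{x\in X: \{y\in Y:(x,y)\in E\}\text{ is not nowhere dense in }Y\}$$ is meager in $X$.
   Context: A set is meager (of first category) if it is a countable union of nowhere dense sets. The game on a topological space $X$: two players play rounds $n=0,1,2,\ldots$. At round $n$, Player I chooses a finite family $\mathcal{A}_n$ of non-empty open subsets of $X$; then Player II chooses a finite family $\mathcal{B}_n$ of non-empty open subsets of $X$ such that for each $U\in\mathcal{A}_n$ there exists $V\in\mathcal{B}_n$ with $V\subseteq U$. Player I wins if for every natural number $k$ the union $\bigcup(\mathcal{B}_k\cup\mathcal{B}_{k+1}\cup\ldots)$ is dense in $X$; otherwise Player II wins. The space $X$ is I-favorable if Player I has a winning strategy, i.e. a function $\sigma$ assigning to each finite sequence $(\mathcal{B}_0,\ldots,\mathcal{B}_n)$ (including the empty sequence) of finite families of non-empty open sets a finite family $\sigma(\mathcal{B}_0,\ldots,\mathcal{B}_n)$ of non-empty open sets, such that Player I wins every game in which $\mathcal{A}_0=\sigma(\emptyset)$ and $\mathcal{A}_{n+1}=\sigma(\mathcal{B}_0,\ldots,\mathcal{B}_n)$ for all $n$. A space $Y$ is universally Kuratowski-Ulam$^*$ (uK-U$^*$) if for every topological space $X$ and every nowhere dense set $E\subseteq X\times Y$, the set $\{x\in X:\{y\in Y:(x,y)\in E\}\text{ is not nowhere dense in }Y\}$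 is meager in $X$. *)

(* Defs.v *)
(* Spaces are [topologicalType]s, possibly empty and with no separation axiom;
   [X * Y] carries its canonical product topology. *)
From mathcomp Require Import all_boot all_order all_algebra.
From mathcomp Require Import all_classical all_reals all_analysis.

Set Implicit Arguments.
Unset Strict Implicit.
Unset Printing Implicit Defensive.

Local Open Scope classical_set_scope.

Definition nowhere_dense (T : topologicalType) (A : set T) : Prop :=
  interior (closure A) = set0.

(* Since [set0] is nowhere dense, finite unions are covered by the nat-indexed
   ones. *)
Definition meager (T : topologicalType) (A : set T) : Prop :=
  exists2 F : nat -> set T,
    forall n, nowhere_dense (F n) & A = \bigcup_n F n.

(* The families played in the game; the empty family is a legal choice. *)
Definition finite_open_family (T : topologicalType) (F : set (set T)) : Prop :=
  finite_set F /\ forall U, F U -> open U /\ U !=set0.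

Definition legal_response (T : topologicalType) (A B : set (set T)) : Prop :=
  finite_open_family B /\
  forall U, A U -> exists2 V, B V & V `<=` U.

Definition player_I_wins (T : topologicalType) (B : nat -> set (set T)) : Prop :=
  forall k : nat,
    dense (\bigcup_(V in \bigcup_(n in [set n | (k <= n)%N]) B n) V).

(* A strategy takes the list [:: B_0; ...; B_(n-1)] of the moves made so far by
   Player II, earliest first, and returns the move A_n of Player I. *)
Definition strategy (T : topologicalType) : Type :=
  seq (set (set T)) -> set (set T).

Definition legal_strategy (T : topologicalType) (sigma : strategy T) : Prop :=
  forall s : seq (set (set T)),
    (forall F, F \in s -> finite_open_family F) ->
    finite_open_family (sigma s).

Definition winning_strategy (T : topologicalType) (sigma : strategy T) : Prop :=
  legal_strategy sigma /\
  forall B : nat -> set (set T),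
    (forall n, legal_response (sigma (mkseq B n)) (B n)) ->
    player_I_wins B.

Definition I_favorable (T : topologicalType) : Prop :=
  exists sigma : strategy T, winning_strategy sigma.

Definition universally_Kuratowski_Ulam_star (Y : topologicalType) : Prop :=
  forall (X : topologicalType) (E : set (X * Y)),
    nowhere_dense E ->
    meager [set x : X | ~ nowhere_dense [set y : Y | E (x, y)]].

(* Main.v *)
(* Let W be the complement of the closure of E, an open dense set. Player I
   follows a winning strategy on Y while Player II answers, simultaneously over
   all x in X, with sets V contained in the section W_x: finitely many challenges
   are answered at once by shrinking a nonempty open O in X so that O * V is
   contained in W. Maximal disjoint families of such O's make the n-th answer a
   locally constant function on an open dense set G_n. If x lies in every G_n, a
   legal play has been built above x; Player I wins it, so W_x contains an open
   dense set and E_x is nowhere dense. The exceptional x's lie in the union of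
   the nowhere dense complements of the G_n. *)
Require Import Defs.
From mathcomp Require Import all_boot all_order all_algebra.
From mathcomp Require Import all_classical all_reals all_analysis.

Local Open Scope classical_set_scope.

Lemma nowhere_dense_subset (T : topologicalType) (A B : set T) :
  A `<=` B -> nowhere_dense B -> nowhere_dense A.
Proof.
move=> AB ndB; apply/seteqP; split => // x Ax.
have : (closure B)° x by apply: interiorS Ax; exact: closureS.
by rewrite ndB.
Qed.

Lemma nowhere_denseC (T : topologicalType) (G : set T) :
  open G -> dense G -> nowhere_dense (~` G).
Proof.
move=> oG dG; apply/seteqP; split => // x.
rewrite closure_setC => ix.
have [||y [/interior_subset yG Gy]] := dG (~` G°)°.
- by exists x.
- exact: open_interior.
- by apply: yG; move: oG Gy; rewrite openE; apply.
Qed.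

Lemma nowhere_dense_dense (T : topologicalType) (A : set T) :
  nowhere_dense A -> dense (~` closure A).
Proof.
move=> ndA O [x Ox] oO; apply: contrapT => ne.
have : (closure A)° x.
  apply: filterS (open_nbhs_nbhs (conj oO Ox)) => y Oy.
  by apply: contrapT => nAy; apply: ne; exists y.
by rewrite ndA.
Qed.

(** By Zorn there is a maximal family of disjoint labelled open pieces. Its union is dense, since a
    nonempty open set missing it would contain one more piece. [m0] is only the value of [f] off the
    union. *)
Lemma dense_locally_constant_choice (X : topologicalType) (M : Type) (m0 : M)
    (P : set X -> M -> Prop) :
  (forall O, open O -> O !=set0 ->
     exists N m, [/\ open N, N !=set0, N `<=` O & P N m]) ->
  exists (f : X -> M) (G : set X),
    [/\ open G, dense G & forall x, G x ->
      exists O, [/\ open O, O x, P O (f x) & forall y, O y -> f y = f x]].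
Proof.
move=> hP.
(* Pieces that meet must be equal as pairs, so no point receives two labels. *)
pose Q (D : set (set X * M)) :=
  (forall p, D p -> open p.1 /\ P p.1 p.2) /\
  (forall p q, D p -> D q -> p.1 `&` q.1 !=set0 -> p = q).
have [|D [[DP Ddisj] Dmax]] := @Zorn_bigcup _ Q.
  move=> F FQ totF; split=> [p [A FA Ap]|p q [A FA Ap] [B FB Bq]].
    by have [+ _] := FQ _ FA; apply.
  have [AB|BA] := totF _ _ FA FB.
    by have [_] := FQ _ FB; apply => //; exact: AB.
  by have [_] := FQ _ FA; apply => //; exact: BA.
have /choice[f fP] x : exists m, forall p, D p -> p.1 x -> m = p.2.
  have [[p [Dp px]]|nD] := EM (exists p, D p /\ p.1 x); last first.
    by exists m0 => p Dp px; case: nD; exists p.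
  exists p.2 => q Dq qx; rewrite (Ddisj p q)//.
  by exists x.
exists f, (\bigcup_(p in D) p.1); split.
- by apply: bigcup_open => p /DP[].
- move=> O O0 oO; apply: contrapT => ODn.
  have [N [m [oN [z Nz] NO PNm]]] := hP _ oO O0.
  have ND p : D p -> ~ (N `&` p.1 !=set0).
    move=> Dp [y [Ny py]]; apply: ODn; exists y; split; first exact: NO.
    by exists p.
  apply: (Dmax (D `|` [set (N, m)])).
    split=> [p Dp|]; first by left.
    move=> /(_ (N, m)) DN; apply: (ND (N, m)); last by exists z.
    by apply: DN; right.
  split=> [p [/DP//|->//]|p q [Dp|->] [Dq|->]] //.
  + exact: Ddisj.
  + by rewrite setIC => /(ND _ Dp).
  + by move=> /(ND _ Dq).
- move=> x [p Dp px]; have [op Pp] := DP _ Dp.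
  exists p.1; split => //; first by rewrite (fP _ _ Dp px).
  by move=> y py; rewrite (fP _ _ Dp px) (fP _ _ Dp py).
Qed.

Lemma open_setX (X Y : topologicalType) (A : set X) (B : set Y) :
  open A -> open B -> open (A `*` B).
Proof.
move=> oA oB; rewrite openE => -[a b] [/= Aa Bb].
by exists (A, B) => //; split; exact: open_nbhs_nbhs.
Qed.

(** Induction on the finitely many challenges: each one shrinks the open set in [X] once more, and
    shrinking preserves the answers already given. *)
Lemma dense_open_legal_response (X Y : topologicalType) (W : set (X * Y))
    (A : set (set Y)) (O : set X) :
  open W -> dense W -> finite_open_family A -> open O -> O !=set0 ->
  exists (O2 : set X) (B : set (set Y)),
    [/\ open O2, O2 !=set0, O2 `<=` O, legal_response A B &
        forall V, B V -> O2 `*` V `<=` W].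
Proof.
move=> oW dW [/finite_seqP[s ->]].
elim: s O => [|U s IHs] O oA oO O0.
  by exists O, set0; split => //; split => //; split => //; exact: finite_set0.
have [|O1 [B [oO1 [x1 O1x1] O1O [[finB oB] sB] BW]]] := IHs O _ oO O0.
  by move=> V sV; apply: oA; rewrite /= inE sV orbT.
have [|oU [y1 Uy1]] := oA U; first by rewrite /= inE eqxx.
have [||[x y] [[/= O1x Uy] Wxy]] := dW (O1 `*` U).
- by exists (x1, y1).
- exact: open_setX.
have : nbhs (x, y) W by apply: open_nbhs_nbhs.
case=> -[N V] [/= Nx Vy] NVW.
exists (O1 `&` N°), ([set U `&` V°] `|` B); split.
- by apply: openI => //; exact: open_interior.
- by exists x.
- by apply: subset_trans O1O => z [].
- split; first split.
  + by rewrite finite_setU; split => //; exact: finite_set1.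
  + move=> V' [->|/oB//]; split; last by exists y.
    by apply: openI => //; exact: open_interior.
  + move=> U' /=; rewrite inE => /predU1P[->|/sB[V' BV' V'U']].
      by exists (U `&` V°); [left|move=> z []].
    by exists V' => //; right.
- move=> V' [->|BV'] [a b] [/= [ O1a Na] Vb].
    by apply: NVW; split => /=; [exact: interior_subset|case: Vb => _ /interior_subset].
  by apply: (BW _ BV').
Qed.

Section plays.
Variables (X Y : topologicalType) (W : set (X * Y)) (sigma : strategy Y).
Hypotheses (oW : open W) (dW : dense W) (legal : legal_strategy sigma).

(** A partial play above every point: [p.1 x] is the history at [x], reliable on [p.2]. Local
    constancy lets [sigma] pose a single challenge on a whole open set. *)
Let good (p : (X -> seq (set (set Y))) * set X) :=
  [/\ open p.2, dense p.2 & forall x, p.2 x ->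
    (forall F, F \in p.1 x -> finite_open_family F) /\
    exists O, [/\ open O, O x & forall y, O y -> p.1 y = p.1 x]].

Let answered (h : seq (set (set Y))) B x :=
  legal_response (sigma h) B /\ forall V, B V -> forall y, V y -> W (x, y).

Let next_round (p : {p | good p}) : exists q : {q | good q},
  forall x, (sval q).2 x ->
    exists2 B, (sval q).1 x = rcons ((sval p).1 x) B &
      answered ((sval p).1 x) B x.
Proof.
case: p => -[h G] [/= oG dG hG].
(* The label [t] is the whole extended history. Legality of [h x] is part of [P] because the new
   pieces need not lie inside [G]. *)
pose P (O : set X) t := exists2 B, finite_open_family B & forall x, O x ->
  [/\ forall F, F \in h x -> finite_open_family F,
      t = rcons (h x) B & answered (h x) B x].
have [ O oO O0|f [G' [oG' dG' fP]]] :=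
    @dense_locally_constant_choice X _ [::] P.
  have [x [Ox Gx]] := dG O O0 oO.
  have [hx [N [oN Nx hN]]] := hG _ Gx.
  have [||M [B [oM M0 MON lB BW]]] := @dense_open_legal_response X Y W
    (sigma (h x)) (O `&` N) oW dW (legal _ hx).
  - exact: openI.
  - by exists x.
  exists M, (rcons (h x) B); split => //; first by move=> z /MON[].
  exists B; first by case: lB.
  move=> y My; rewrite (hN y); last by case: (MON _ My).
  by split => //; split => // V BV z Vz; apply: (BW _ BV).
suff gq : good (f, G').
  exists (exist _ (f, G') gq) => x /= /fP[ O [_ Ox [B _ /(_ _ Ox)[_ -> ?]] _]].
  by exists B.
split => //= x /fP[ O [oO Ox [B fB /(_ _ Ox)[hx fx _]] fO]]; split.
  by move=> F; rewrite fx mem_rcons inE => /predU1P[->//|]; exact: hx.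
by exists O.
Qed.

Lemma dense_open_plays : exists G : nat -> set X,
  (forall n, open (G n) /\ dense (G n)) /\
  forall x, (forall n, G n x) -> exists B : nat -> set (set Y),
    (forall n, legal_response (sigma (mkseq B n)) (B n)) /\
    forall n V, B n V -> forall y, V y -> W (x, y).
Proof.
have g0 : good (fun=> [::], setT).
  split => //=; first exact: openT.
    by move=> O [x Ox] _; exists x.
  by move=> x _; split => //; exists setT; split => //; exact: openT.
have [next nextP] := choice next_round.
pose p n := iter n next (exist _ _ g0).
exists (fun n => (sval (p n)).2); split.
  by move=> n; case: (svalP (p n)).
move=> x Gx; pose h n := (sval (p n)).1 x.
(* Above a fixed [x], each history extends the previous one by one answer, so together they form a
   single infinite play. *)
have /choice[B BP] n : exists B, h n.+1 = rcons (h n) B /\ answered (h n) B x.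
  by have [B ? ?] := nextP (p n) x (Gx n.+1); exists B.
have hB n : h n = mkseq B n.
  by elim: n => // n IHn; rewrite (BP n).1 IHn mkseqS.
exists B; split=> n; last by case: (BP n) => _ [_]; apply.
by rewrite -hB; case: (BP n) => _ [].
Qed.

End plays.

Theorem theorem8 (Y : topologicalType) (hY : I_favorable Y) :
  universally_Kuratowski_Ulam_star Y.
Proof.
case: hY => sigma [legal win] X E ndE.
pose W := ~` closure E.
have oW : open W by apply: closed_openC; exact: closed_closure.
have [G [Gopen GP]] :=
  dense_open_plays X Y W sigma oW (nowhere_dense_dense _ _ ndE) legal.
pose bad := [set x : X | ~ nowhere_dense [set y : Y | E (x, y)]].
(* [meager] asks for an equality, hence the intersection with [bad]. *)
exists (fun n => ~` G n `&` bad).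
  move=> n; apply: (@nowhere_dense_subset _ _ (~` G n)); first by move=> x [].
  by have [] := Gopen n; exact: nowhere_denseC.
rewrite -/bad; apply/seteqP; split=> [x badx|x [n _ []]//].
apply: contrapT => nGx; apply: (badx).
have [n|B [lB BW]] := GP x.
  by apply: contrapT => nGn; apply: nGx; exists n.
apply/seteqP; split => // y Ey.
(* The case [k = 0] suffices: some answer [V] meets the interior of the closure of the section of
   [E]. Being open, [V] then meets the section itself, although the fibre of [V] above [x] lies in
   [W]. *)
have [||z [Ez [V [n _ BnV] Vz]]] := win B lB 0%N (closure [set y | E (x, y)])°.
- by exists y.
- exact: open_interior.
have [oV _] : open V /\ V !=set0 by have [[_ +] _] := lB n; apply.
have [|w [Ew Vw]] := interior_subset Ez V; first exact: open_nbhs_nbhs.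
by apply: (BW _ _ BnV w Vw); exact: subset_closure.
Qed.
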